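(* There is a universal constant $C$ such that for every $T$ and every sequence of outcomes $\mathbf x\in\{0,1\}^T$ fixed in advance, the forecasts $\mathbf p$ produced by the algorithm ForecastHedge satisfy $\mathbb E[\mathrm{VCal}(\mathbf p,\mathbf x)]\le C\sqrt T$, i.e. $\mathbb E[\mathrm{VCal}(\mathbf p,\mathbf x)]=O(\sqrt T)$.
   Context: ForecastHedge: let $S(z)=e^z/(e^z+e^{-z})$ and $\eta=1/\sqrt T$. Predict $p_1=1/2$. For $t=2,\dots,T$, let $\hat x_{t-1}=\frac1{t-1}\sum_{s=1}^{t-1}x_s$ and sample $p_t\in[0,1]$ (independently of previous randomness) from the distribution with $\Pr[p_t\le v]=S(\eta(t-1)(v-\hat x_{t-1}))$ for all $v\in[0,1)$ (and $\Pr[p_t\le 1]=1$); then observe $x_t$. For $\beta=\frac1T\sum_tx_t$ and a scoring rule $\ell:[0,1]\times\{0,1\}\to\mathbb R$, $\mathrm{Reg}_\ell(\mathbf p,\mathbf x)=\sum_t\ell(p_t,x_t)-\sum_t\ell(\beta,x_t)$. For $v\in[0,1]$, the V-shaped scoring rule is $\ell_v(p,0)=v\,\mathrm{sgn}(p-v)$, $\ell_v(p,1)=(1-v)\,\mathrm{sgn}(v-p)$ with $\mathrm{sgn}(0)=0$, and $\mathrm{VCal}(\mathbf p,\mathbf x)=\sup_{v\in[0,1]}\mathrm{Reg}_{\ell_v}(\mathbf p,\mathbf x)$. *)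

(* Defs.v *)
From HB Require Import structures.
From mathcomp Require Import all_boot all_order all_algebra.
From mathcomp Require Import all_classical all_reals all_analysis.
From mathcomp Require Import Rstruct Rstruct_topology.
Set Implicit Arguments. Unset Strict Implicit. Unset Printing Implicit Defensive.
Import Order.TTheory GRing.Theory Num.Theory.
Local Open Scope classical_set_scope.
Local Open Scope ring_scope.

Notation RR := (Rdefinitions.R : realType).

Definition Sfun (z : RR) : RR := expR z / (expR z + expR (- z)).

Definition eta (T : nat) : RR := (Num.sqrt (T%:R : RR))^-1.

Definition xr (x : nat -> bool) (t : nat) : RR := (x t)%:R.

(* hat x_{t-1} = (1/(t-1)) sum_{s=1}^{t-1} x_s  (rounds t are 1,...,T) *)
Definition xhat (x : nat -> bool) (t : nat) : RR :=
  (t.-1%:R)^-1 * \sum_(1 <= s < t) xr x s.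

(* The CDF prescribed by ForecastHedge for round t >= 2, on [0,1]:
   Pr[p_t <= v] = S(eta (t-1) (v - xhat_{t-1})) for v in [0,1), and 1 at v = 1. *)
Definition fh_cdf (T : nat) (x : nat -> bool) (t : nat) (v : RR) : RR :=
  if v < 1 then Sfun (eta T * t.-1%:R * (v - xhat x t)) else 1.

Definition beta (T : nat) (x : nat -> bool) : RR :=
  (T%:R)^-1 * \sum_(1 <= t < T.+1) xr x t.

(* V-shaped scoring rule ell_v, sgn(0) = 0 (Num.sg) *)
Definition ellV (v p : RR) (b : bool) : RR :=
  if b then (1 - v) * Num.sg (v - p) else v * Num.sg (p - v).

Definition RegV (T : nat) (v : RR) (p : nat -> RR) (x : nat -> bool) : RR :=
  \sum_(1 <= t < T.+1) ellV v (p t) (x t)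
  - \sum_(1 <= t < T.+1) ellV v (beta T x) (x t).

Definition VCal (T : nat) (p : nat -> RR) (x : nat -> bool) : \bar RR :=
  ereal_sup [set (RegV T v p x)%:E | v in `[0, 1]%classic].

Definition mutually_independent d (Omega : measurableType d)
    (P : probability Omega RR) (T : nat) (X : nat -> Omega -> RR) : Prop :=
  forall B : nat -> set RR, (forall t, measurable (B t)) ->
    (P (\bigcap_(t in [set t | (1 <= t <= T)%N]) (X t @^-1` B t)) =
     \prod_(1 <= t < T.+1) P (X t @^-1` B t))%E.

Definition forecast_hedge d (Omega : measurableType d)
    (P : probability Omega RR) (T : nat) (x : nat -> bool)
    (p : nat -> Omega -> RR) : Prop :=
  [/\ forall t, measurable_fun setT (p t),
      forall w, p 1%N w = 2^-1,
      forall t w, (2 <= t <= T)%N -> 0 <= p t w <= 1,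
      forall t v, (2 <= t <= T)%N -> 0 <= v <= 1 ->
        P [set w | p t w <= v] = (fh_cdf T x t v)%:E
    & mutually_independent P T p].

(* Main.v *)
Require Import Defs.
From HB Require Import structures.
From mathcomp Require Import all_boot all_order all_algebra.
From mathcomp Require Import all_classical all_reals all_analysis.
From mathcomp Require Import Rstruct Rstruct_topology.
From mathcomp Require Import measurable_realfun.
From mathcomp Require Import ring lra.
Set Implicit Arguments. Unset Strict Implicit. Unset Printing Implicit Defensive.
Import Order.TTheory GRing.Theory Num.Theory.
Import numFieldNormedType.Exports.
Local Open Scope classical_set_scope.
Local Open Scope ring_scope.

(** Since [ell_v(p, x) = (v - x) sgn(p - v)], the regret of the rule [ell_v] is
    [sum_t (v - x_t) sgn(p_t - v) + T |v - beta|].  For a fixed [v] its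
    expectation is [O(sqrt T)], because [Pr[p_t <= v]] is the Hedge weight of one
    of the two experts +1 and -1 with gains [v - x_t].  For the supremum over [v],
    take the grid of mesh [1/T].  As the logistic function is Lipschitz, each open
    cell contains [O(sqrt T)] forecasts on average, so only the fluctuations of the
    empirical process at the [O(T)] grid points remain.  By independence the fourth
    moment of an increment carrying expected mass [V] is at most [3 V^2 + V], and
    Billingsley's maximal inequality gives [E max = O(sqrt T)] without the
    logarithmic factor of a union bound. *)

(** * Hedge with two experts *)

(** Inverting [1 - b / 2 <= expR (- (b / 2))] bounds [expR (b / 2)] from above by
    [1 + b / 2 + b ^+ 2 / 2]; squaring gives the claim. *)
Lemma expR_le_quadratic (R : realType) (b : R) :
  `|b| <= 1 -> expR b <= 1 + b + 2 * b ^+ 2.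
Proof.
move=> hb; have /andP[b1 b2] : -1 <= b <= 1 by rewrite -ler_norml.
have h1 : 1 - b / 2 <= expR (- (b / 2)) by have := expR_ge1Dx (- (b / 2)).
have h2 : expR (b / 2) * expR (- (b / 2)) = 1 by rewrite -exp.expRD subrr exp.expR0.
have h3 : expR b = expR (b / 2) ^+ 2 by rewrite -expRM_natl; congr expR; field.
have h0 : 0 < expR (b / 2) by exact: expR_gt0.
have h4 : expR (b / 2) <= 1 + b / 2 + b ^+ 2 / 2.
  have k1 : expR (b / 2) * (1 - b / 2) <= 1 by rewrite -[leRHS]h2 ler_pM2l.
  have k2 : 1 <= (1 + b / 2 + b ^+ 2 / 2) * (1 - b / 2) by nra.
  have k3 : 0 < 1 - b / 2 by lra.
  by rewrite -(ler_pM2r k3); apply: le_trans k2.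
rewrite h3; apply: (@le_trans _ _ ((1 + b / 2 + b ^+ 2 / 2) ^+ 2)).
  by rewrite lerXn2r // nnegrE; nra.
have : b ^+ 2 <= 1 by nra.
have : 0 <= b ^+ 2 by exact: sqr_ge0.
nra.
Qed.

Section logistic.
Variable R : realType.

(** [Sfun] over an arbitrary [realType]; at [RR] the two are convertible. *)
Definition logistic (z : R) : R := expR z / (expR z + expR (- z)).

Lemma logistic_den_ge1 (z : R) : 1 <= expR z + expR (- z).
Proof. by have := expR_ge1Dx z; have := expR_ge1Dx (- z); lra. Qed.

Lemma logistic_den_gt0 (z : R) : 0 < expR z + expR (- z).
Proof. exact: lt_le_trans (logistic_den_ge1 z). Qed.

Lemma logistic_ge0_le1 (z : R) : 0 <= logistic z <= 1.
Proof.
have := logistic_den_gt0 z; have := expR_gt0 z; have := expR_gt0 (- z) => h1 h2 h3.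
rewrite /logistic divr_ge0 ?(ltW h2) ?(ltW h3)//= ler_pdivrMr //; lra.
Qed.

(** Over a common denominator the difference is [expR (b - a) - expR (a - b)] divided by a product
    of two factors that are at least 1. With [d = b - a] in [0, 1] the numerator is at most
    [2 d + 2 d^2 <= 4 d]. *)
Lemma logistic_lipschitz (a b : R) : 0 <= b - a <= 1 -> logistic b - logistic a <= 4 * (b - a).
Proof.
move=> /andP[d0 d1].
have dp : expR (b - a) <= 1 + (b - a) + 2 * (b - a) ^+ 2.
  by apply: expR_le_quadratic; rewrite ger0_norm.
have dm : 1 - (b - a) <= expR (a - b).
  by have := expR_ge1Dx (a - b); lra.
have num : expR (b - a) - expR (a - b) <= 4 * (b - a) by nra.
have Da := logistic_den_ge1 a; have Db := logistic_den_ge1 b.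
have Da0 := logistic_den_gt0 a; have Db0 := logistic_den_gt0 b.
have -> : logistic b - logistic a = (expR (b - a) - expR (a - b)) /
    ((expR a + expR (- a)) * (expR b + expR (- b))).
  rewrite /logistic !exp.expRD; field; apply/andP; split; exact: lt0r_neq0.
rewrite ler_pdivrMr; last exact: mulr_gt0.
apply: (le_trans num); rewrite ler_peMr ?mulr_ge0 //.
by rewrite mulr_ege1.
Qed.

Lemma logistic_continuous : continuous logistic.
Proof.
move=> z; rewrite /continuous_at /logistic.
apply: (@cvgM _ _ (nbhs z) _ expR (fun u => (expR u + expR (- u))^-1)).
  exact: continuous_expR.
apply: (@cvgV _ _ (nbhs z) _ (fun u => expR u + expR (- u))).
  exact/lt0r_neq0/logistic_den_gt0.
apply: (@cvgD _ _ _ (nbhs z) _ expR (fun u => expR (- u))).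
  exact: continuous_expR.
apply: (@cvg_comp _ _ _ -%R expR _ (nbhs (- z))).
  exact: opp_continuous.
exact: continuous_expR.
Qed.

(* The potential exp(c L) + exp(-c L) of Hedge with the two experts +1 and -1
   grows at each round by a factor at most exp(c y (2 S(c L) - 1) + 2 c^2). *)
Lemma hedge_regret (n : nat) (y : nat -> R) (c : R) :
    0 < c <= 1 -> (forall i, `|y i| <= 1) ->
  \sum_(i < n) y i * (1 - 2 * logistic (c * \sum_(k < i) y k)) + `|\sum_(k < n) y k|
    <= (1 + 2 * n%:R * c ^+ 2) / c.
Proof.
move=> /andP[c0 c1] y1.
pose L m := \sum_(k < m) y k.
pose G m := \sum_(i < m) y i * (1 - 2 * logistic (c * L i)).
have Psi m : expR (c * L m) + expR (- (c * L m)) <=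
    2 * expR (2 * m%:R * c ^+ 2 - c * G m).
  elim: m => [|m IH].
    by rewrite /L /G !big_ord0 !(mulr0, mul0r, oppr0, subr0, addr0) !exp.expR0; lra.
  have LS : c * L m.+1 = c * L m + c * y m by rewrite /L big_ord_recr mulrDr.
  set a := c * L m in IH LS *; set b := c * y m in LS *.
  have b1 : `|b| <= 1.
    by rewrite normrM (gtr0_norm c0) -[leRHS]mulr1 ler_pM // ltW.
  have bc : b ^+ 2 <= c ^+ 2.
    rewrite exprMn -[leRHS]mulr1 ler_wpM2l ?sqr_ge0 //.
    by rewrite -real_normK ?num_real // expr_le1.
  have hp := expR_le_quadratic b1.
  have hm : expR (- b) <= 1 + - b + 2 * (- b) ^+ 2.
    by apply: expR_le_quadratic; rewrite normrN.
  have D0 := logistic_den_gt0 a.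
  have Sa : logistic a * (expR a + expR (- a)) = expR a by rewrite divfK // lt0r_neq0.
  rewrite LS opprD (exp.expRD a) (exp.expRD (- a)).
  (* The quadratic bound is applied to both exponentials; since [logistic a] is the share of
     [expR a] in the potential, the first-order parts combine to [b * (2 * logistic a - 1)]. *)
  apply: (@le_trans _ _ ((expR a + expR (- a)) * (1 + (2 * c ^+ 2 + b * (2 * logistic a - 1))))).
    have := expR_gt0 a; have := expR_gt0 (- a) => em ep.
    have kp := ler_wpM2l (ltW ep) hp.
    have km := ler_wpM2l (ltW em) hm.
    have kb := ler_wpM2l (ltW D0) bc.
    have -> : (expR a + expR (- a)) * (1 + (2 * c ^+ 2 + b * (2 * logistic a - 1))) =
      (expR a + expR (- a)) * (1 - b) + 2 * ((expR a + expR (- a)) * c ^+ 2)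
      + 2 * b * (logistic a * (expR a + expR (- a))) by ring.
    rewrite Sa; lra.
  apply: (@le_trans _ _ ((expR a + expR (- a)) * expR (2 * c ^+ 2 + b * (2 * logistic a - 1)))).
    by rewrite ler_wpM2l ?(ltW D0) // expR_ge1Dx.
  apply: (le_trans (ler_wpM2r (expR_ge0 _) IH)).
  rewrite -[leLHS]mulrA ler_pM2l //.
  rewrite -exp.expRD ler_expR.
  rewrite /G big_ord_recr /= -/(G m) -/a.
  rewrite -(natr1 m) mulrDr /b; lra.
(* One of the two exponentials is that of [c * |L n|], and the factor 2 is absorbed by
   [2 <= expR 1], whence the summand 1. *)
have key : c * `|L n| <= 1 + (2 * n%:R * c ^+ 2 - c * G n).
  rewrite -ler_expR exp.expRD.
  have e1 : 2 <= expR (1 : R) by have := expR_ge1Dx (1 : R); lra.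
  apply: (@le_trans _ _ (expR (c * L n) + expR (- (c * L n)))); last first.
    by apply: (le_trans (Psi n)); rewrite ler_wpM2r // expR_ge0.
  have := expR_gt0 (c * L n); have := expR_gt0 (- (c * L n)).
  by have [_|_] := ger0P (L n); rewrite ?mulrN; lra.
rewrite ler_pdivlMr // mulrDl mulrC [X in _ + X]mulrC -/(G n) -/(L n).
lra.
Qed.

End logistic.

(** * Fourth moments and a maximal inequality for product weights *)

(** Convexity of the fourth power with weights 8/9 and 1/9; equality at [a = 8 b] explains the
    square factored out. The first coefficient has to stay below 2 for the maximal inequality to
    close under halving. *)
Lemma quartic_split (R : realFieldType) (a b : R) :
  (a + b) ^+ 4 <= 729 / 512 * a ^+ 4 + 729 * b ^+ 4.
Proof.
rewrite -subr_ge0.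
have -> : 729 / 512 * a ^+ 4 + 729 * b ^+ 4 - (a + b) ^+ 4 =
  (a - 8 * b) ^+ 2 * (217 / 512 * a ^+ 2 + 89 / 32 * a * b + 91 / 8 * b ^+ 2) by field.
apply: mulr_ge0; first exact: sqr_ge0.
have := sqr_ge0 (a * 217 + 712 * b); have := sqr_ge0 b; nra.
Qed.

(** Turns a fourth moment of order [tau ^+ 4] into a first moment of order [tau]. *)
Lemma norm_le_quartic (R : realFieldType) (y tau : R) : 0 < tau ->
  `|y| <= tau + y ^+ 4 / tau ^+ 3.
Proof.
move=> t0.
have -> : y ^+ 4 = `|y| ^+ 4 by rewrite -normrX ger0_norm // exprn_even_ge0.
have := normr_ge0 y; move: `|y| => {y} y y0.
have t3 : 0 < tau ^+ 3 by exact: exprn_gt0.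
have [yt|/ltW ty] := leP y tau.
  by apply: (le_trans yt); rewrite lerDl divr_ge0 ?exprn_ge0 ?(ltW t0).
apply: (@le_trans _ _ (y ^+ 4 / tau ^+ 3)); last by rewrite lerDr ltW.
by rewrite ler_pdivlMr // (exprS y 3) ler_wpM2l // lerXn2r // nnegrE ltW.
Qed.

Section product_expectation.
Variables (R : realFieldType) (A : finType).

(** Expectation under a product of finite weights. The weights are indexed by [nat], so that
    splitting off the first coordinate is a mere shift of [pi]. *)
Definition expect n (pi : nat -> A -> R) (g : n.-tuple A -> R) : R :=
  \sum_(s : n.-tuple A) (\prod_(i < n) pi i (tnth s i)) * g s.

Lemma expectS n pi (g : n.+1.-tuple A -> R) :
  expect pi g = \sum_a pi 0%N a * expect (fun i => pi i.+1) (fun s => g [tuple of a :: s]).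
Proof.
rewrite /expect; under [RHS]eq_bigr do rewrite mulr_sumr.
rewrite pair_big /=.
rewrite (reindex (fun u : A * n.-tuple A => [tuple of u.1 :: u.2])) /=; last first.
  exists (fun s => (thead s, [tuple of behead s])) => [[a s] _|s _] /=.
    by congr pair; apply/val_inj.
  by rewrite -tuple_eta.
apply: eq_bigr => -[a s] _ /=; rewrite big_ord_recl mulrA; congr (_ * _ * _).
by apply: eq_bigr => i _; rewrite tnthS.
Qed.

Lemma expect0 pi (g : 0.-tuple A -> R) : expect pi g = g [tuple].
Proof.
rewrite /expect (bigD1 [tuple]) //= big_ord0 mul1r big1 ?addr0 // => s.
by rewrite (tuple0 s) => /eqP[]; exact: val_inj.
Qed.

Lemma eq_expect n pi (f g : n.-tuple A -> R) : f =1 g -> expect pi f = expect pi g.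
Proof. by move=> fg; apply: eq_bigr => s _; rewrite fg. Qed.

Lemma expectD n pi (f g : n.-tuple A -> R) :
  expect pi (fun s => f s + g s) = expect pi f + expect pi g.
Proof. by rewrite -big_split; apply: eq_bigr => s _; rewrite mulrDr. Qed.

Lemma expectZ n pi c (f : n.-tuple A -> R) : expect pi (fun s => c * f s) = c * expect pi f.
Proof. by rewrite /expect mulr_sumr; apply: eq_bigr => s _; rewrite mulrCA. Qed.

Lemma expect_cst n pi c : (forall i, \sum_a pi i a = 1) ->
  expect pi (fun _ : n.-tuple A => c) = c.
Proof.
elim: n pi => [|n IH] pi p1; first by rewrite expect0.
rewrite expectS; under eq_bigr do rewrite IH //.
by rewrite -mulr_suml p1 mul1r.
Qed.

(* The shifted fourth moment is a polynomial in the shift [y], and polynomials of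
   this shape are preserved when one more independent summand is averaged out. *)
Lemma fourth_moment_aux n pi (f : nat -> A -> R) (u : nat -> R) :
    (forall i a, 0 <= pi i a) -> (forall i, \sum_a pi i a = 1) ->
    (forall i, \sum_a pi i a * f i a = 0) -> (forall i a, `|f i a| <= 1) ->
    (forall i, \sum_a pi i a * f i a ^+ 2 <= u i) ->
  exists v m3 m4, let V := \sum_(i < n) u i in
    [/\ 0 <= v <= V, m4 <= 3 * V ^+ 2 + V
      & forall y, expect pi (fun s : n.-tuple A => (y + \sum_(i < n) f i (tnth s i)) ^+ 4)
          = y ^+ 4 + 6 * y ^+ 2 * v + 4 * y * m3 + m4].
Proof.
elim: n pi f u => [|n IH] pi f u p0 p1 f0 f1 fu.
  exists 0, 0, 0 => /=; rewrite big_ord0; split => [||y]; [lra|lra|].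
  by rewrite expect0 big_ord0; ring.
have [v [m3 [m4 /= [vV m4V E]]]] := IH (fun i => pi i.+1) (fun i => f i.+1)
  (fun i => u i.+1) (fun i => p0 i.+1) (fun i => p1 i.+1) (fun i => f0 i.+1)
  (fun i => f1 i.+1) (fun i => fu i.+1).
pose e k := \sum_a pi 0%N a * f 0%N a ^+ k.
have e2 : 0 <= e 2%N by apply: sumr_ge0 => a _; rewrite mulr_ge0 // sqr_ge0.
have e4 : e 4%N <= e 2%N.
  apply: ler_sum => a _; rewrite ler_wpM2l //.
  have : f 0%N a ^+ 2 <= 1 by rewrite -real_normK ?num_real // expr_le1.
  by have := sqr_ge0 (f 0%N a); nra.
have eu : e 2%N <= u 0%N by exact: fu.
(* [v], [m3] and [m4] are the second, third and fourth moments of the sum. Centring removes every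
   term with [e 1], and the new cross term [6 * v * e 2] is paid for by the cross term of
   [3 * (u 0 + V) ^+ 2]. *)
exists (v + e 2%N), (m3 + e 3%N), (m4 + 6 * v * e 2%N + e 4%N).
rewrite /= big_ord_recl.
have -> : \sum_(i < n) u (lift ord0 i) = \sum_(i < n) u i.+1.
  by apply: eq_bigr => i _; rewrite lift0.
move: vV m4V; set V := \sum_(i < n) _ => vV m4V; split => [||y]; first lra.
- have : v * e 2%N <= V * u 0%N by apply: ler_pM; lra.
  nra.
rewrite expectS.
transitivity (\sum_a pi 0%N a * ((y + f 0%N a) ^+ 4 + 6 * (y + f 0%N a) ^+ 2 * v
    + 4 * (y + f 0%N a) * m3 + m4)).
  apply: eq_bigr => a _; rewrite -E; congr (_ * _); apply: eq_expect => s /=.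
  rewrite big_ord_recl addrA; congr ((_ + _ + _) ^+ 4).
  by apply: eq_bigr => i _; rewrite tnthS.
transitivity (\sum_a ((y ^+ 4 + 6 * y ^+ 2 * v + 4 * y * m3 + m4) * pi 0%N a
    + (4 * y ^+ 3 + 12 * y * v + 4 * m3) * (pi 0%N a * f 0%N a)
    + (6 * y ^+ 2 + 6 * v) * (pi 0%N a * f 0%N a ^+ 2)
    + (4 * y) * (pi 0%N a * f 0%N a ^+ 3) + pi 0%N a * f 0%N a ^+ 4)).
  by apply: eq_bigr => a _; ring.
rewrite !big_split -!mulr_sumr /= p1 f0 -!/(e _).
ring.
Qed.

Lemma fourth_moment n pi (f : nat -> A -> R) (u : nat -> R) :
    (forall i a, 0 <= pi i a) -> (forall i, \sum_a pi i a = 1) ->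
    (forall i, \sum_a pi i a * f i a = 0) -> (forall i a, `|f i a| <= 1) ->
    (forall i, \sum_a pi i a * f i a ^+ 2 <= u i) ->
  expect pi (fun s : n.-tuple A => (\sum_(i < n) f i (tnth s i)) ^+ 4)
    <= 3 * (\sum_(i < n) u i) ^+ 2 + \sum_(i < n) u i.
Proof.
move=> p0 p1 f0 f1 fu.
have [v [m3 [m4 /= [_ m4V E]]]] := fourth_moment_aux n p0 p1 f0 f1 fu.
have := E 0; under eq_expect do rewrite add0r; move=> ->.
by rewrite !(expr0n, mulr0, mul0r, add0r).
Qed.

(* Billingsley's argument: cut [i, j] at the first [h] reaching half of the mass,
   and apply the induction hypothesis on both sides of [h].  The constant 2600
   closes the induction because 729/512 * (1/4 + 1/4) * 2600 + 729 <= 2600. *)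
Lemma fourth_moment_maximal n pi (X : nat -> n.-tuple A -> R) (mu : nat -> R) (M : nat) :
    (forall i a, 0 <= pi i a) -> (forall i, \sum_a pi i a = 1) ->
    (forall i j, (i <= j)%N -> mu i <= mu j) ->
    (forall i j, (i <= j <= M)%N ->
       expect pi (fun s => (X j s - X i s) ^+ 4) <= (mu j - mu i) ^+ 2) ->
  forall i j, (i <= j <= M)%N -> exists Z,
    [/\ forall k s, (i <= k <= j)%N -> (X k s - X i s) ^+ 4 <= Z s
      & expect pi Z <= 2600 * (mu j - mu i) ^+ 2].
Proof.
move=> p0 p1 muh hX i j; have [d] := ubnP (j - i)%N.
elim: d i j => // d IH i j jd /andP[ij jM].
have [eij|nij] := eqVneq i j.
  exists (fun=> 0); split => [k s /andP[ik kj]|].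
    have -> : k = i by apply/eqP; rewrite eqn_leq ik eij kj.
    by rewrite subrr expr0n.
  by rewrite (expect_cst _ _ p1) eij subrr expr0n mulr0 lexx.
have ltij : (i < j)%N by rewrite ltn_neqAle nij.
pose c := (mu j - mu i) / 2.
have exh : exists h, (i < h)%N && (c <= mu h - mu i).
  by exists j; rewrite ltij /=; have := muh _ _ ij; rewrite /c; lra.
case: (ex_minnP exh) => h /andP[ih ch] hmin.
have hj : (h <= j)%N by apply: hmin; rewrite ltij /=; have := muh _ _ ij; rewrite /c; lra.
have h0 : (h.-1.+1 = h)%N by rewrite prednK //; apply: leq_trans ih.
have ih1 : (i <= h.-1)%N by rewrite -ltnS h0.
have c1 : mu h.-1 - mu i <= c.
  have [e|ne] := eqVneq h.-1 i.
    by rewrite e subrr /c; have := muh _ _ ij; lra.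
  rewrite leNgt; apply/negP => /ltW hc.
  have := hmin h.-1; rewrite hc ltn_neqAle ih1 eq_sym ne /= => /(_ isT).
  by rewrite leqNgt -{2}h0 ltnSn.
have [||Z1 [Z1h EZ1]] := IH i h.-1.
- rewrite -ltnS; apply: leq_trans jd; rewrite ltnS ltn_sub2r // h0; exact: hj.
- by rewrite ih1 /=; apply: leq_trans (leq_pred _) (leq_trans hj jM).
have [||Z2 [Z2h EZ2]] := IH h j.
- rewrite -ltnS; apply: leq_trans jd; rewrite ltnS; exact: ltn_sub2l.
- by rewrite hj.
have q4 (y : R) : 0 <= y ^+ 4 by rewrite exprn_even_ge0.
(* For [k < h] the majorant [Z1] suffices; for [k >= h] the increment passes through [h] and
   [quartic_split] applies. The sum [Z1 + Z2] stands in for a maximum. *)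
exists (fun s => 729 / 512 * (Z1 s + Z2 s) + 729 * (X h s - X i s) ^+ 4); split.
  move=> k s /andP[ik kj].
  have z1 : 0 <= Z1 s by apply: (le_trans (q4 _) (Z1h i s _)); rewrite leqnn.
  have z2 : 0 <= Z2 s by apply: (le_trans (q4 _) (Z2h h s _)); rewrite leqnn.
  have [kh|hk] := ltnP k h.
    have := Z1h k s; rewrite ik -ltnS h0 kh => /(_ isT).
    by have := q4 (X h s - X i s); lra.
  have := Z2h k s; rewrite hk kj => /(_ isT).
  have := quartic_split (X k s - X h s) (X h s - X i s).
  have -> : X k s - X h s + (X h s - X i s) = X k s - X i s by ring.
  lra.
rewrite expectD !expectZ expectD.
have Eh : expect pi (fun s => (X h s - X i s) ^+ 4) <= (mu j - mu i) ^+ 2.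
  apply: le_trans (hX _ _ _) _; first by rewrite ltnW //= (leq_trans hj).
  have := muh _ _ hj; have := muh _ _ (ltnW ih); nra.
have E1 : (mu h.-1 - mu i) ^+ 2 <= (mu j - mu i) ^+ 2 / 4.
  have := muh _ _ ih1; move: c1; rewrite /c; nra.
have E2 : (mu j - mu h) ^+ 2 <= (mu j - mu i) ^+ 2 / 4.
  have := muh _ _ hj; move: ch; rewrite /c; nra.
have := sqr_ge0 (mu j - mu i); lra.
Qed.

End product_expectation.

(** An increment of the weighted, centred empirical distribution function is a sum of independent
    centred terms whose variances are at most the masses of the cell. The maximal inequality then
    bounds the fourth power of the maximum by [O(tau ^+ 4)], as the grid has only [O(n)] points. *)
Lemma empirical_process_max (R : realFieldType) n M (pi : nat -> 'I_M -> R)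
    (c : nat -> R) (tau : R) (F := fun j i => \sum_a pi i a * (a < j)%N%:R) :
    (0 < n)%N -> (M <= 3 * n)%N -> 0 < tau -> tau ^+ 2 = n%:R ->
    (forall i a, 0 <= pi i a) -> (forall i, \sum_a pi i a = 1) ->
    (forall i, `|c i| <= 1) ->
  exists Z : n.-tuple 'I_M -> R,
    (forall j (s : n.-tuple 'I_M), (j <= M)%N ->
       `|\sum_(i < n) c i * ((tnth s i < j)%N%:R - F j i)| <= Z s)
    /\ expect pi Z <= (64 * 2600 + 1) * tau.
Proof.
move=> n0 Mn t0 tn p0 p1 c1.
pose W j (s : n.-tuple 'I_M) := \sum_(i < n) c i * ((tnth s i < j)%N%:R - F j i).
(* Adding the index [j] to the mass makes every increment of [mu] at least 1,
   which absorbs the linear term of the bound [3 V^2 + V]. *)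
pose mu j := 2 * (\sum_(i < n) F j i + j%:R).
have Fle i j t : (i <= j)%N -> F i t <= F j t.
  move=> ij; apply: ler_sum => a _; rewrite ler_wpM2l // ler_nat.
  by case: (ltnP a i) => // ai; rewrite (leq_trans ai ij).
have muh i j : (i <= j)%N -> mu i <= mu j.
  move=> ij; rewrite ler_pM2l // lerD ?ler_nat //.
  by apply: ler_sum => t _; exact: Fle.
have F01 j t : 0 <= F j t <= 1.
  apply/andP; split; first by apply: sumr_ge0 => a _; rewrite mulr_ge0.
  rewrite -(p1 t); apply: ler_sum => a _.
  by rewrite -[leRHS]mulr1 ler_wpM2l // lern1 leq_b1.
have hX i j : (i <= j <= M)%N ->
    expect pi (fun s => (W j s - W i s) ^+ 4) <= (mu j - mu i) ^+ 2.
  move=> /andP[ij _].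
  pose d (a : 'I_M) : R := (a < j)%N%:R - (a < i)%N%:R.
  have dd a : d a = 0 \/ d a = 1.
    rewrite /d; case: (ltnP a i) => [ai|_].
      by rewrite (leq_trans ai ij); left; rewrite subrr.
    by case: (a < j)%N; [right|left]; rewrite subr0.
  pose q t := F j t - F i t.
  have q0 t : 0 <= q t by rewrite subr_ge0; exact: Fle.
  have q1 t : q t <= 1.
    by have := F01 j t; have := F01 i t; rewrite /q => /andP[? ?] /andP[? ?]; lra.
  have qE t : q t = \sum_a pi t a * d a.
    by rewrite /q /F -sumrB; apply: eq_bigr => a _; rewrite -mulrBr.
  pose f t a := c t * (d a - q t).
  have -> : expect pi (fun s => (W j s - W i s) ^+ 4) =
      expect pi (fun s : n.-tuple 'I_M => (\sum_(t < n) f t (tnth s t)) ^+ 4).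
    apply: eq_expect => s; congr (_ ^+ 4); rewrite /W -sumrB; apply: eq_bigr => t _.
    by rewrite /f /d /q; ring.
  apply: (le_trans (@fourth_moment _ _ n pi f q p0 p1 _ _ _)).
  - move=> t; rewrite /f; under eq_bigr do rewrite mulrCA mulrBr.
    by rewrite -mulr_sumr sumrB -qE -mulr_suml p1 mul1r subrr mulr0.
  - move=> t a; rewrite normrM mulr_ile1 //.
    have := q0 t; have := q1 t.
    by case: (dd a) => ->; rewrite ler_norml; lra.
  (* As [d a] is 0 or 1, the averaged expression is [(d a - q t) ^+ 2], and its mean is the
     Bernoulli variance [q t - q t ^+ 2 <= q t]. *)
  - move=> t; apply: (@le_trans _ _ (\sum_a pi t a * (d a * (1 - 2 * q t) + q t ^+ 2))).
      apply: ler_sum => a _; rewrite ler_wpM2l // /f exprMn.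
      have c2 : c t ^+ 2 <= 1 by rewrite -real_normK ?num_real // expr_le1.
      apply: (le_trans (ler_wpM2r (sqr_ge0 _) c2)); rewrite mul1r.
      by case: (dd a) => ->; lra.
    under eq_bigr do rewrite mulrDr mulrA.
    rewrite big_split /= -!mulr_suml -qE p1; have := q0 t; have := q1 t; nra.
  have -> : \sum_(t < n) q t = \sum_(t < n) F j t - \sum_(t < n) F i t by rewrite sumrB.
  set V := _ - _.
  have V0 : 0 <= V by rewrite subr_ge0; apply: ler_sum => t _; exact: Fle.
  have -> : mu j - mu i = 2 * (V + (j%:R - i%:R)) by rewrite /mu /V; ring.
  have [eij|nij] := eqVneq i j; first by rewrite /V eij !subrr; lra.
  have : i%:R + 1 <= j%:R :> R by rewrite natr1 ler_nat ltn_neqAle nij.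
  by nra.
have [Z [ZW EZ]] := fourth_moment_maximal p0 p1 muh hX (leqnn M : (0 <= M <= M)%N).
exists (fun s => tau + tau ^- 3 * Z s); split=> [j s jM|].
  have := ZW j s jM.
  have W0 : W 0%N s = 0.
    by rewrite /W big1 // => t _; rewrite /F big1 ?subr0 ?mulr0 // => a _; rewrite mulr0.
  rewrite W0 subr0 => WZ; apply: (le_trans (norm_le_quartic _ t0)).
  by rewrite lerD2l mulrC ler_pM2l ?invr_gt0 ?exprn_gt0.
rewrite expectD expectZ expect_cst //.
(* The mass is at most [2 * (n + M) <= 8 * n]; its square gives the factor 64 in the final
   constant. *)
have mu8 : mu M - mu 0%N <= 8 * tau ^+ 2.
  have -> : mu 0%N = 0.
    by rewrite /mu big1 ?addr0 ?mulr0 // => t _; rewrite /F big1 // => a _; rewrite mulr0.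
  rewrite subr0 /mu tn.
  have : \sum_(t < n) F M t <= n%:R.
    apply: (@le_trans _ _ (\sum_(t < n) 1)); last by rewrite sumr_const card_ord.
    by apply: ler_sum => t _; case/andP: (F01 M t).
  have : M%:R <= 3 * n%:R :> R by rewrite -natrM ler_nat.
  lra.
have mu0 : 0 <= mu M - mu 0%N by rewrite subr_ge0 muh.
have EZ' : expect pi Z <= 64 * 2600 * tau ^+ 4.
  apply: (le_trans EZ); have : (mu M - mu 0%N) ^+ 2 <= (8 * tau ^+ 2) ^+ 2.
    by rewrite lerXn2r // nnegrE // (le_trans mu0).
  have -> : (8 * tau ^+ 2) ^+ 2 = 64 * tau ^+ 4 by ring.
  lra.
have -> : (64 * 2600 + 1) * tau = tau + tau ^- 3 * (64 * 2600 * tau ^+ 4).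
  by field; exact: lt0r_neq0.
by rewrite lerD2l ler_wpM2l // invr_ge0 exprn_ge0 // ltW.
Qed.

(** * Reduction of the regret to a grid *)

(* The test index j is shifted by one from the grid point (j-1)/m, leaving j = 0
   for the empty set.  [r < 1] is a separate test because p_t has an atom at 1. *)
Definition below (R : realFieldType) (m j : nat) (r : R) : bool :=
  if j is j'.+1 then
    if (j' < m)%N then r <= j'%:R / m%:R else (j' == m) ==> (r < 1)
  else false.

Lemma below_mono (R : realFieldType) m i j (r : R) : (i <= j)%N -> below m i r -> below m j r.
Proof.
have step k : below m k r -> below m k.+1 r.
  case: k => [//|k] /=.
  have [km|] := ltnP k m; last first.
    rewrite leq_eqVlt => /orP[/eqP <-|mk] _; first by rewrite ltnNge leqnSn /= gtn_eqF.
    by rewrite ltnNge (ltnW (leqW mk)) /= gtn_eqF // ltnW.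
  have m0 : 0 < m%:R :> R by rewrite ltr0n (leq_ltn_trans _ km).
  move=> rk; case: ifP => [_|_].
    by apply: (le_trans rk); rewrite ler_pM2r ?invr_gt0 // ler_nat.
  apply/implyP => _; apply: (le_lt_trans rk).
  by rewrite ltr_pdivrMr // mul1r ltr_nat.
by move=> /subnK <-; elim: (j - i)%N => // d IH /IH; rewrite addSn; exact: step.
Qed.

(** Round [v] down to a grid point [a] less than or equal to [1/T] away. The coefficients [v - x i]
    and the term [T * |v - b|] each change by at most 1 in total, and the sign can differ only for
    forecasts in the cell of [v], at cost at most 2 each. *)
Lemma regret_le_grid (R : realFieldType) T (v b : R) (p x : nat -> R) (B N : R) :
    (0 < T)%N -> 0 <= v <= 1 -> (forall i : 'I_T, 0 <= p i <= 1) ->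
    (forall i : 'I_T, 0 <= x i <= 1) -> T%:R * b = \sum_(i < T) x i ->
    0 <= B -> 0 <= N ->
    (forall j, (1 <= j <= T.+1)%N ->
      \sum_(i < T) (j.-1%:R / T%:R - x i) * (1 - 2 * (below T j (p i))%:R)
        + T%:R * `|j.-1%:R / T%:R - b| <= B) ->
    (forall j, (1 <= j <= T)%N ->
      \sum_(i < T) ((below T j.+1 (p i))%:R - (below T j (p i))%:R) <= N) ->
  \sum_(i < T) (v - x i) * Num.sg (p i - v) + T%:R * `|v - b| <= B + 2 + 2 * N.
Proof.
move=> T0 /andP[v0 v1] p01 x01 Tb B0 N0 HB HN.
have T0' : 0 < T%:R :> R by rewrite ltr0n.
have /andP[b0 b1] : 0 <= b <= 1.
  rewrite -(pmulr_rge0 _ T0') -(ler_pM2l T0' _ 1) Tb mulr1.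
  apply/andP; split; first by apply: sumr_ge0 => i _; case/andP: (x01 i).
  apply: (@le_trans _ _ (\sum_(i < T) 1)); last by rewrite sumr_const card_ord.
  by apply: ler_sum => i _; case/andP: (x01 i).
(* At [v = 0] forecasts equal to [v] have sign 0, so the sign is the mean of [1 - 2 * (p i <= 0)]
   and the constant 1; the regret becomes half of the quantity bounded by [B]. At [v = 1] the
   constant is -1 and the test is [p i < 1]. *)
have [->|vn0] := eqVneq v 0.
  have := HB 1%N isT; rewrite /= T0 mul0r !sub0r normrN (ger0_norm b0).
  suff -> : \sum_(i < T) (0 - x i) * Num.sg (p i - 0) =
      (\sum_(i < T) (0 - x i) * (1 - 2 * (p i <= 0)%R%:R) - T%:R * b) / 2.
    by lra.
  rewrite Tb // -sumrB mulr_suml; apply: eq_bigr => i _.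
  have /andP[pi0 _] := p01 i; rewrite subr0.
  have [pi|pi] := leP (p i) 0.
    have -> : p i = 0 by apply/eqP; rewrite eq_le pi pi0.
    by rewrite sgr0 /=; field.
  by rewrite gtr0_sg //=; field.
have [->|vn1] := eqVneq v 1.
  have := HB T.+1; rewrite leqnn /= ltnn eqxx /= divff ?lt0r_neq0 // => /(_ isT).
  have n1 : `|1 - b| = 1 - b by rewrite ger0_norm // subr_ge0.
  rewrite n1.
  suff -> : \sum_(i < T) (1 - x i) * Num.sg (p i - 1) =
      (\sum_(i < T) (1 - x i) * (1 - 2 * (p i < 1)%R%:R)
       - T%:R * (1 - b)) / 2.
    by lra.
  have -> : T%:R * (1 - b) = \sum_(i < T) (1 - x i).
    by rewrite mulrBr mulr1 Tb // sumrB sumr_const card_ord.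
  rewrite -sumrB mulr_suml; apply: eq_bigr => i _.
  have /andP[_ pi1] := p01 i.
  have [pi|pi] := ltP (p i) 1.
    by rewrite ltr0_sg ?subr_lt0 //=; field.
  have -> : p i = 1 by apply/eqP; rewrite eq_le pi pi1.
  by rewrite subrr sgr0 /=; field.
have {vn0}v0 : 0 < v by rewrite lt_neqAle eq_sym vn0.
have {vn1}v1 : v < 1 by rewrite lt_neqAle vn1.
have [j /andP[jT /andP[av va']]] : exists j, (j < T)%N &&
    (j%:R / T%:R < v <= j.+1%:R / T%:R).
  have exn : exists n, v * T%:R <= n%:R by exists T; rewrite ler_piMl ?ltW.
  case: (ex_minnP exn) => -[|n] vn nmin.
    by move: vn; rewrite leNgt mulr_gt0.
  exists n; rewrite ltr_pdivrMr // ler_pdivlMr // vn andbT.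
  rewrite (nmin T) /=; last by rewrite ler_piMl ?ltW.
  by rewrite ltNge; apply/negP => /nmin; rewrite ltnn.
set a := j%:R / T%:R in av va'.
have aT : T%:R * (v - a) <= 1.
  rewrite [leRHS](_ : 1 = T%:R * (j.+1%:R / T%:R - a)); last first.
    by rewrite /a -natr1; field; exact: lt0r_neq0.
  by rewrite ler_pM2l // lerB.
have absb : T%:R * `|v - b| <= T%:R * `|a - b| + T%:R * (v - a).
  rewrite -(mulrDr T%:R `|a - b|) ler_pM2l // -(ger0_norm (x := v - a)); last first.
    by rewrite subr_ge0 ltW.
  by apply: le_trans (ler_normD _ _); rewrite [in leRHS]addrC subrKA.
have HBj := HB j.+1 (leqW jT); have HNj := HN j.+1 jT.
rewrite -[j.+1.-1]/j -/a in HBj.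
(* The comparison holds term by term: the value at [a], the price of moving from [a] to [v], and 2
   for a forecast lying in the cell. *)
suff : \sum_(i < T) (v - x i) * Num.sg (p i - v) <=
   \sum_(i < T) ((a - x i) * (1 - 2 * (below T j.+1 (p i))%:R) + (v - a)
    + 2 * ((below T j.+2 (p i))%:R - (below T j.+1 (p i))%:R)).
  rewrite big_split [X in _ <= X + _]big_split /= -mulr_sumr sumr_const card_ord.
  by rewrite -(mulr_natl (v - a)); lra.
apply: ler_sum => i _; have /andP[x0 x1] := x01 i.
have below1 : below T j.+1 (p i) = (p i <= a) by rewrite /= jT.
have [d1|d1] := boolP (below T j.+1 (p i)).
  rewrite (below_mono _ d1) //; move: d1; rewrite below1 => pa.
  rewrite ltr0_sg; first by move=> /=; lra.
  by rewrite subr_lt0; apply: le_lt_trans av.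
have [d2|d2] := boolP (below T j.+2 (p i)).
  by case: sgrP => _ /=; lra.
have pv : v < p i.
  move: d2 => /=; case: ifP => _; first by rewrite -ltNge; apply: le_lt_trans.
  by rewrite negb_imply -leNgt => /andP[_]; apply: lt_le_trans.
by rewrite gtr0_sg ?subr_gt0 //=; lra.
Qed.

Lemma sum_increments (R : pzRingType) (q : nat -> R) M j : (j <= M)%N ->
  \sum_(a < M) (q a.+1 - q a) * (a < j)%N%:R = q j - q 0%N.
Proof.
move=> jM; rewrite -(telescope_sumr q (leq0n j)).
rewrite (big_nat_widen _ _ _ _ _ jM) big_mkord [RHS]big_mkcond; apply: eq_bigr => a _.
by case: (a < j)%N => /=; rewrite ?mulr1 ?mulr0.
Qed.

(** [hedge_regret] with [c = tau^-1], where [q i] is the probability of forecasting at most [a]. The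
    first forecast does not follow the logistic law; replacing its weight costs at most 2. *)
Lemma forecast_hedge_expected_regret (R : realType) T (x : nat -> R)
    (q : nat -> R) (a tau : R) :
    (0 < T)%N -> 0 < tau -> tau ^+ 2 = T%:R -> (forall i, 0 <= x i <= 1) ->
    0 <= a <= 1 -> 0 <= q 0%N <= 1 ->
    (forall i, (0 < i < T)%N -> q i = logistic (tau^-1 * \sum_(k < i) (a - x k))) ->
  \sum_(i < T) (a - x i) * (1 - 2 * q i) + `|\sum_(i < T) (a - x i)| <= 3 * tau + 2.
Proof.
move=> T0 t0 tT x01 /andP[a0 a1] /andP[q0 q1] qE.
have T1 : 1 <= T%:R :> R by rewrite ler1n.
have y1 i : `|a - x i| <= 1.
  by have /andP[? ?] := x01 i; rewrite ler_norml; lra.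
have c01 : 0 < tau^-1 <= 1.
  rewrite invr_gt0 t0 invf_le1 //= leNgt; apply/negP => t1.
  by move: T1; rewrite -tT; nra.
have := hedge_regret T c01 y1.
have -> : (1 + 2 * T%:R * tau^-1 ^+ 2) / tau^-1 = 3 * tau.
  by rewrite -tT; field; exact: lt0r_neq0.
set A1 := \sum_(i < T) _ * _; set A2 := \sum_(i < T) _ * _ => H.
suff : A2 - A1 <= 2 by lra.
rewrite /A1 /A2 -sumrB; clear A1 A2 H.
case: T T0 qE {T1 tT} => // n _ qE.
rewrite big_ord_recl [X in _ + X]big1 ?addr0 => [|i _]; last first.
  by rewrite lift0 qE ?subrr //= ltnS.
have := y1 0%N; rewrite ler_norml => /andP[? ?].
have /andP[l0 l1] := logistic_ge0_le1 (tau^-1 * \sum_(k < 0) (a - x k)).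
rewrite /=; set l := logistic _ in l0 l1 *; nra.
Qed.

(** The argument without a probability space: [Q j i] is the probability that the forecast of round
    [i + 1] passes test [j], and [s] records the cell of each forecast. The majorant [G] depends on
    the cells alone and serves all [v] at once. *)
Lemma finite_forecast_hedge (R : realType) T (x : nat -> R) (Q : nat -> nat -> R)
    (tau : R) :
    (0 < T)%N -> 0 < tau -> tau ^+ 2 = T%:R -> (forall i, 0 <= x i <= 1) ->
    (forall i, Q 0%N i = 0) -> (forall i, Q T.+2 i = 1) ->
    (forall i j, Q j i <= Q j.+1 i) ->
    (forall i j, (0 < i < T)%N -> (0 < j <= T.+1)%N ->
      Q j i = logistic (tau^-1 * \sum_(k < i) (j.-1%:R / T%:R - x k))) ->
  exists G : T.-tuple 'I_(T.+2) -> R,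
    [/\ forall s, 0 <= G s,
        expect (fun i (a : 'I_(T.+2)) => Q a.+1 i - Q a i) G <= (64 * 2600 + 4) * 8 * tau
      & forall (s : T.-tuple 'I_(T.+2)) (p : nat -> R) (v b : R),
          (forall i : 'I_T, 0 <= p i <= 1) ->
          (forall (i : 'I_T) j, (j <= T.+2)%N -> (tnth s i < j)%N = below T j (p i)) ->
          0 <= v <= 1 -> T%:R * b = \sum_(i < T) x i ->
          \sum_(i < T) (v - x i) * Num.sg (p i - v) + T%:R * `|v - b| <= G s].
Proof.
move=> T0 t0 tT x01 Q0 QT Qmono QE.
pose pi i (a : 'I_T.+2) := Q a.+1 i - Q a i.
have T0' : 0 < T%:R :> R by rewrite ltr0n.
have tau1 : 1 <= tau.
  have T1 : 1 <= tau ^+ 2 by rewrite tT ler1n.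
  by rewrite leNgt; apply/negP => t1; nra.
have FE i j : (j <= T.+2)%N -> \sum_a pi i a * (a < j)%N%:R = Q j i.
  by move=> jT; rewrite (sum_increments (fun k => Q k i) jT) Q0 subr0.
have p0 i a : 0 <= pi i a by rewrite subr_ge0.
have p1 i : \sum_a pi i a = 1.
  by rewrite -(QT i) -FE //; apply: eq_bigr => a _; rewrite ltn_ord mulr1.
have Q01 i j : (j <= T.+2)%N -> 0 <= Q j i <= 1.
  move=> jT; rewrite -FE //; apply/andP; split.
    by apply: sumr_ge0 => a _; rewrite mulr_ge0.
  rewrite -[leRHS](p1 i); apply: ler_sum => a _.
  by case: (a < j)%N; rewrite ?mulr1 ?mulr0.
have M3 : (T.+2 <= 3 * T)%N by rewrite -addn2 mulSn leq_add2l leq_pmulr.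
have normr1_le : `|1 : R| <= 1 by rewrite normr1.
(* The fluctuation of the regret at a grid point [a] is affine in [a], so the two processes with
   coefficients 1 and [x i] control all grid points. *)
have [Z1 [Z1W EZ1]] := empirical_process_max (c := fun=> 1) T0 M3 t0 tT p0 p1
  (fun=> normr1_le).
have x1 i : `|x i| <= 1 by have /andP[? ?] := x01 i; rewrite ger0_norm.
have [Z2 [Z2W EZ2]] := empirical_process_max T0 M3 t0 tT p0 p1 x1.
have Z10 s : 0 <= Z1 s by apply: le_trans (normr_ge0 _) (Z1W 0%N s _).
have Z20 s : 0 <= Z2 s by apply: le_trans (normr_ge0 _) (Z2W 0%N s _).
(* This is [B + 2 + 2 * N] with [B = 3 * tau + 2 + 2 * Z1 + 2 * Z2] and [N = 1 + 4 * tau + 2 * Z1];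
   since [tau >= 1], the additive constant 6 is absorbed in its expectation. *)
exists (fun s => (11 * tau + 6) + (6 * Z1 s + 2 * Z2 s)); split => [s||].
- by have := Z10 s; have := Z20 s; lra.
- by rewrite -/pi !expectD !expectZ !(expect_cst _ _ p1); lra.
move=> s p v b p01 sp v01 Tb.
have B0 : 0 <= 3 * tau + 2 + 2 * Z1 s + 2 * Z2 s.
  by have := Z10 s; have := Z20 s; lra.
have N0 : 0 <= 1 + 4 * tau + 2 * Z1 s by have := Z10 s; lra.
suff : \sum_(i < T) (v - x i) * Num.sg (p i - v) + T%:R * `|v - b| <=
    (3 * tau + 2 + 2 * Z1 s + 2 * Z2 s) + 2 + 2 * (1 + 4 * tau + 2 * Z1 s) by lra.
apply: regret_le_grid => //.
- move=> j /andP[j0 jT]; set a := _ / _.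
  have a01 : 0 <= a <= 1.
    by rewrite divr_ge0 //= ler_pdivrMr // mul1r ler_nat -ltnS prednK.
  have := forecast_hedge_expected_regret T0 t0 tT x01 a01
    (Q01 0%N j (leqW jT)) (fun i iT => QE i j iT (introT andP (conj j0 jT))).
  have -> : T%:R * `|a - b| = `|\sum_(i < T) (a - x i)|.
    rewrite sumrB sumr_const card_ord -Tb -(mulr_natl a) -mulrBr.
    by rewrite normrM (ger0_norm (ltW T0')).
  have := Z1W j s (leqW jT); have := Z2W j s (leqW jT).
  set W2 := \sum_(i < T) _ => W2Z; set W1 := \sum_(i < T) _ => W1Z.
  have -> : \sum_(i < T) (a - x i) * (1 - 2 * (below T j (p i))%:R) =
     \sum_(i < T) (a - x i) * (1 - 2 * Q j i) - 2 * (a * W1) + 2 * W2.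
    rewrite /W1 /W2 !mulr_sumr -sumrB -big_split; apply: eq_bigr => i _ /=.
    by rewrite FE ?(leqW jT) // sp ?(leqW jT) //; ring.
  have : `|a * W1| <= Z1 s.
    case/andP: a01 => a0 a1; rewrite normrM (ger0_norm a0).
    by apply: le_trans W1Z; rewrite ler_piMl.
  move: W2Z; rewrite !ler_norml => /andP[? ?] /andP[? ?]; lra.
move=> j /andP[j0 jT].
have jT1 : (j.+1 <= T.+2)%N by exact: leqW.
have jT2 : (j <= T.+2)%N by exact/leqW/leqW.
have := Z1W j s jT2; have := Z1W j.+1 s (leqW jT).
set W' := \sum_(i < T) _ * _ => WZ'; set W := \sum_(i < T) _ * _ => WZ.
have -> : \sum_(i < T) ((below T j.+1 (p i))%:R - (below T j (p i))%:R) =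
    \sum_(i < T) (Q j.+1 i - Q j i) + (W' - W).
  rewrite /W /W' -sumrB -big_split; apply: eq_bigr => i _.
  by rewrite -(sp i _ jT1) -(sp i _ jT2) /= !FE //; ring.
suff : \sum_(i < T) (Q j.+1 i - Q j i) <= 1 + 4 * tau.
  by move: WZ WZ'; rewrite !ler_norml => /andP[? ?] /andP[? ?]; lra.
(* The first forecast may put its whole mass in one cell. In round [i + 1] the logistic argument
   moves by [i / (tau * T) <= 1 / tau] across a cell, hence mass at most [4 / tau]. *)
apply: (@le_trans _ _ (\sum_(i < T) ((i == 0 :> nat)%:R + 4 / tau))).
  apply: ler_sum => i _; have [->|i0] := eqVneq (i : nat) 0%N.
    have /andP[? ?] := Q01 0%N j.+1 jT1; have /andP[? ?] := Q01 0%N j jT2.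
    have t4 : 0 < 4 / tau by exact: divr_gt0.
    by move=> /=; lra.
  have iT' : (0 < i < T)%N by rewrite lt0n i0 /=.
  have jT3 : (0 < j <= T.+1)%N by rewrite j0 leqW.
  rewrite add0r (QE _ j.+1 iT' jT) (QE _ _ iT' jT3) /=.
  set u := tau^-1 * \sum_(k < i) (j%:R / T%:R - x k); set u' := tau^-1 * _.
  have uE : u - u' = tau^-1 * (i%:R / T%:R).
    rewrite /u /u' -mulrBr -sumrB; congr (_ * _).
    transitivity (\sum_(k < i) (T%:R^-1 : R)); last by rewrite sumr_const card_ord mulr_natl.
    apply: eq_bigr => k _; rewrite -(prednK j0) -natr1 /=; field.
    exact: lt0r_neq0.
  have iT : 0 <= (i%:R / T%:R : R) <= 1.
    by rewrite divr_ge0 //= ler_pdivrMr // mul1r ler_nat ltnW.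
  have ti : 0 < tau^-1 <= 1 by rewrite invr_gt0 t0 invf_le1.
  have d1 : 0 <= u - u' <= 1 by rewrite uE; case/andP: iT => ? ?; case/andP: ti => ? ?; nra.
  apply: (le_trans (logistic_lipschitz d1)); rewrite ler_pM2l // uE.
  by case/andP: iT => ? ?; case/andP: ti => ? ?; nra.
rewrite big_split /= sumr_const card_ord.
have -> : 4 / tau *+ T = 4 * tau :> R.
  by rewrite -mulr_natl -tT; field; exact: lt0r_neq0.
rewrite lerD2r (bigD1 (Ordinal T0)) //= big1 ?addr0 // => i.
by rewrite -val_eqE => /negPf /= ->.
Qed.

(** * From the probability space to product weights *)

Section transfer.
Variables (R : realType) (d : measure_display) (T : measurableType d).
Local Open Scope ereal_scope.

(** Both integrals are suprema over simple functions below the integrand. Measurability is not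
    assumed because [f] will be [VCal], a supremum over uncountably many [v]. *)
Lemma ge0_le_integral_nomeas (mu : {measure set T -> \bar R}) (f g : T -> \bar R) :
  (forall x, 0 <= f x) -> (forall x, f x <= g x) ->
  \int[mu]_x f x <= \int[mu]_x g x.
Proof.
move=> f0 fg; have g0 x : 0 <= g x by exact: le_trans (f0 x) (fg x).
rewrite !ge0_integralE //; apply: le_ereal_sup => _ [h hf <-].
exists h => // x; apply: le_trans (hf x) _.
by rewrite !patchE; case: ifP.
Qed.

Variables (P : probability T R) (n : nat) (X : nat -> T -> R).
Variables (A : finType) (C : A -> set R).
Hypothesis mX : forall i, measurable_fun setT (X i).
Hypothesis mC : forall a, measurable (C a).
Hypothesis indep : forall B : nat -> set R, (forall t, measurable (B t)) ->
  P (\bigcap_(t in [set t | (1 <= t <= n)%N]) (X t @^-1` B t)) =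
  \prod_(1 <= t < n.+1) P (X t @^-1` B t).

(** The events [E s], one for each tuple of cells, cover the space, so [f] is at most the sum of
    [G s] times their indicators. Independence makes [P (E s)] a product. *)
Lemma integral_le_expect (f : T -> \bar R) (G : n.-tuple A -> R) :
    (forall w, 0 <= f w) -> (forall s, (0 <= G s)%R) ->
    (forall w (i : 'I_n), exists a, C a (X i.+1 w)) ->
    (forall w s, (forall i : 'I_n, C (tnth s i) (X i.+1 w)) -> f w <= (G s)%:E) ->
  \int[P]_w f w <= (expect (fun i a => fine (P (X i.+1 @^-1` C a))) G)%:E.
Proof.
move=> f0 G0 cov fG.
(* Rounds are numbered from 1 and tuple entries from 0; [setT] is a default for rounds after [n],
   which do not enter [E]. *)
pose B (s : n.-tuple A) t :=
  if (insub t.-1 : option 'I_n) is Some i then C (tnth s i) else setT.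
have mB s t : measurable (B s t) by rewrite /B; case: insubP.
have Bi s (i : 'I_n) : B s i.+1 = C (tnth s i).
  by rewrite /B /=; case: insubP => [j _ /val_inj ->|] //; rewrite ltn_ord.
have mXC i (D : set R) : measurable D -> measurable (X i @^-1` D).
  by move=> mD; rewrite -[_ @^-1` _]setTI; exact: mX.
pose E s := \bigcap_(t in [set t | (1 <= t <= n)%N]) (X t @^-1` B s t).
have mE s : measurable (E s).
  by apply: bigcap_measurableType => t _; exact: mXC.
have PE s : P (E s) = (\prod_(i < n) fine (P (X i.+1 @^-1` C (tnth s i))))%:E.
  rewrite /E indep // big_add1 big_mkord -prodEFin; apply: eq_bigr => i _.
  by rewrite Bi fineK // fin_num_measure //; exact: mXC.
apply: (@le_trans _ _ (\int[P]_w \sum_(s : n.-tuple A) ((G s)%:E * (\1_(E s) w)%:E))).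
  apply: ge0_le_integral_nomeas => // w.
  have [a aw] := boolp.choice (cov w).
  pose s := [tuple a i | i < n].
  have si i : C (tnth s i) (X i.+1 w) by rewrite tnth_mktuple.
  have Es : E s w.
    move=> t /= /andP[t1 tn]; rewrite -(prednK t1) in tn *.
    by have := si (Ordinal tn); rewrite -Bi.
  rewrite (bigD1 s) //= indicE mem_set // mule1.
  apply: (le_trans (fG _ _ si)); rewrite leeDl //.
  by apply: sume_ge0 => s' _; rewrite mule_ge0 ?lee_fin.
rewrite ge0_integral_sum //; last 2 first.
- move=> s; apply: measurable_funeM; apply/measurable_EFinP.
  exact: measurable_indic.
- by move=> s w _; rewrite mule_ge0 ?lee_fin.
rewrite /expect -sumEFin; apply: lee_sum => s _.
rewrite ge0_integralZl //; last 2 first.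
- by apply/measurable_EFinP; exact: measurable_indic.
- by rewrite lee_fin.
have -> : \int[P]_w (\1_(E s) w)%:E =
    (\prod_(i < n) fine (P (X i.+1 @^-1` C (tnth s i))))%:E.
  by rewrite integral_indic // setIT; exact: PE.
by rewrite -EFinM mulrC.
Qed.

End transfer.

Section left_limit.
Variables (R : realType) (d : measure_display) (Omega : measurableType d).
Variables (P : probability Omega R) (X : Omega -> R).
Hypothesis mX : measurable_fun setT X.

(** Continuity of [P] from below along the events [X <= b - 1/(n+1)]. The law is prescribed only to
    the left of [b], which allows for an atom at [b]. *)
Lemma prob_lt_left_limit (F : R -> R) (b : R) :
    {for b, continuous F} -> (forall v, b - 1 <= v < b -> P [set w | X w <= v] = (F v)%:E) ->
  P [set w | X w < b] = (F b)%:E.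
Proof.
move=> Fc PF; pose E (n : nat) := [set w | X w <= b - n.+1%:R^-1].
have mE n : measurable (E n).
  rewrite (_ : E n = setT `&` X @^-1` `]-oo, b - n.+1%:R^-1]); first exact: mX.
  by apply/seteqP; split => w /=; rewrite in_itv /= => // -[].
have EU : \bigcup_n E n = [set w | X w < b].
  apply/seteqP; split => w /=.
    by move=> [n _]; rewrite /E /= => /le_lt_trans; apply; rewrite ltrBlDr ltrDl.
  rewrite -subr_gt0 => Xb.
  exists (Num.truncn (b - X w)^-1) => //; rewrite /E /= lerBrDl -lerBrDr.
  by rewrite invf_ple ?posrE // ltW // truncnS_gt.
have mU : measurable (\bigcup_n E n) by exact: bigcup_measurable.
have ndE : nondecreasing_seq E.
  move=> m n mn; apply/subsetPset => w; rewrite /E /= => /le_trans; apply.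
  by rewrite lerB // lef_pV2 ?posrE // ler_nat.
have c1 := nondecreasing_cvg_mu (mu := P) mE mU ndE.
have c2 : P \o E @ \oo --> (F b)%:E.
  have -> : P \o E = (fun n => (F (b - n.+1%:R^-1))%:E).
    apply/funext => n /=; apply: PF; rewrite lerB ?invf_le1 ?ler1n //=.
    by rewrite ltrBlDr ltrDl.
  apply/fine_cvgP; split; first exact: nearW.
  have cb : (fun n => b - n.+1%:R^-1) @ \oo --> b.
    by rewrite -[X in _ --> X](subr0 b); apply: cvgB; [exact: cvg_cst|exact: cvg_harmonic].
  exact: (cvg_comp (fun n : nat => b - n.+1%:R^-1) F cb Fc).
by rewrite -EU; exact: (cvg_unique (@ereal_hausdorff R) c1 c2).
Qed.

End left_limit.

Lemma logistic_affine_continuous (R : realType) (c h b : R) :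
  {for b, continuous (fun v => logistic (c * (v - h)))}.
Proof.
have cb : (fun v => c * (v - h)) @ b --> c * (b - h).
  by apply: cvgM; [exact: cvg_cst|apply: cvgB; [exact: cvg_id|exact: cvg_cst]].
exact: (cvg_comp _ _ cb (@logistic_continuous R _)).
Qed.

Lemma measurable_below (R : realType) m j : measurable [set r : R | below m j r].
Proof.
have E (c : R) : [set r | r <= c] = `]-oo, c]%classic.
  by apply/seteqP; split => r /=; rewrite in_itv.
have E' (c : R) : [set r | r < c] = `]-oo, c[%classic.
  by apply/seteqP; split => r /=; rewrite in_itv.
case: j => [|j] /=.
  by rewrite (_ : [set _ | _] = set0) //; apply/seteqP; split.
case: (ltnP j m) => _; first by rewrite E.
case: eqP => _ /=; first by rewrite E'.
by rewrite (_ : [set _ | _] = setT) //; apply/seteqP; split.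
Qed.

Lemma fine_probD (R : realType) d (Omega : measurableType d)
    (P : probability Omega R) (A B : set Omega) :
  measurable A -> measurable B -> A `<=` B ->
  fine (P (B `\` A)) = fine (P B) - fine (P A).
Proof.
move=> mA mB AB; rewrite measureD //; last by rewrite -ge0_fin_numE // fin_num_measure.
by rewrite setIidr // fineB // fin_num_measure.
Qed.

(** * ForecastHedge *)

Lemma sum_ge1_ord (F : nat -> RR) T :
  \sum_(1 <= t < T.+1) F t = \sum_(i < T) F i.+1.
Proof. by rewrite big_add1 big_mkord. Qed.

Lemma ellVE (v r : RR) b : ellV v r b = (v - b%:R) * Num.sg (r - v).
Proof.
case: b => /=; last by rewrite subr0.
by rewrite -(opprB v r) sgrN mulrN -mulNr opprB.
Qed.

Lemma betaE T x : (0 < T)%N -> T%:R * beta T x = \sum_(i < T) xr x i.+1.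
Proof. by move=> T0; rewrite /beta mulVKf ?pnatr_eq0 -?lt0n // sum_ge1_ord. Qed.

Lemma xr_ge0_le1 x t : 0 <= xr x t <= 1.
Proof. by rewrite /xr; case: (x t); rewrite ?lexx ?ler01. Qed.

(** Since the [v - x_t] sum to [T * (v - beta)], the benchmark loss is [T * (v - beta) * sgn(beta -
    v) = - T * |v - beta|]. *)
Lemma RegVE T (v : RR) p x : (0 < T)%N ->
  RegV T v p x = \sum_(i < T) (v - xr x i.+1) * Num.sg (p i.+1 - v)
                 + T%:R * `|v - beta T x|.
Proof.
move=> T0; rewrite /RegV !sum_ge1_ord.
under eq_bigr do rewrite ellVE.
under [X in _ - X]eq_bigr do rewrite ellVE.
congr (_ + _).
rewrite -mulr_suml sumrB sumr_const card_ord -[X in X - _]mulr_natl.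
rewrite [X in _ - X](_ : _ = T%:R * beta T x); last by rewrite betaE.
rewrite -mulrBr -mulrA -mulrN; congr (_ * _).
rewrite -(opprB v) sgrN mulrN opprK.
by rewrite [RHS]normrEsg mulrC.
Qed.

(** Clearing the denominator of the running mean exhibits the argument of [S] as the learning rate
    times a cumulative gain, that is, the form treated by [hedge_regret]. *)
Lemma hedge_argE (T : nat) x (i : nat) (v : RR) : (0 < i)%N ->
  Defs.eta T * i%:R * (v - xhat x i.+1)
  = (Num.sqrt (T%:R : RR))^-1 * \sum_(k < i) (v - xr x k.+1).
Proof.
move=> i0; rewrite -mulrA; congr (_ * _).
rewrite /xhat sum_ge1_ord sumrB sumr_const card_ord mulrBr mulr_natl.
by rewrite mulVKf // pnatr_eq0 -lt0n.
Qed.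

Section forecast_hedge.
Variables (d : measure_display) (Omega : measurableType d) (P : probability Omega RR).
Variables (T : nat) (x : nat -> bool) (p : nat -> Omega -> RR).
Hypotheses (T0 : (0 < T)%N) (fh : forecast_hedge P T x p).

Lemma measurable_forecast i (D : set RR) : measurable D -> measurable (p i @^-1` D).
Proof.
by case: fh => mp _ _ _ _ mD; rewrite -[_ @^-1` _]setTI; exact: mp.
Qed.

(** For [j <= T] the test reads the prescribed distribution function at a grid point below 1. For
    [j = T.+1] it is [r < 1]; the distribution function jumps at 1, so the value is obtained as a
    left limit. *)
Lemma forecast_below i j : (0 < i < T)%N -> (0 < j <= T.+1)%N ->
  P (p i.+1 @^-1` [set r | below T j r]) =
  (logistic ((Num.sqrt (T%:R : RR))^-1
     * \sum_(k < i) (j.-1%:R / T%:R - xr x k.+1)))%:E.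
Proof.
case: fh => mp _ p01 cdf _ /andP[i0 iT]; case: j => // j.
have T0' : 0 < T%:R :> RR by rewrite ltr0n.
have it : (2 <= i.+1 <= T)%N by rewrite ltnS i0.
have cdfv v : 0 <= v < 1 -> P [set w | p i.+1 w <= v] =
    (logistic ((Defs.eta T * i%:R) * (v - xhat x i.+1)))%:E.
  by move=> /andP[v0 v1]; rewrite cdf ?v0 ?ltW // /fh_cdf v1.
rewrite -hedge_argE //= ltnS leq_eqVlt => /orP[/eqP ->|jT].
  rewrite (_ : _ @^-1` _ = [set w | p i.+1 w < 1]); last first.
    by apply/seteqP; split => w /=; rewrite ltnn eqxx.
  rewrite divff ?lt0r_neq0 //.
  apply: (prob_lt_left_limit (mp i.+1)
    (F := fun v => logistic (Defs.eta T * i%:R * (v - xhat x i.+1)))).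
    exact: logistic_affine_continuous.
  by move=> v; rewrite subrr; exact: cdfv.
rewrite -cdfv; last by rewrite divr_ge0 //= ltr_pdivrMr // mul1r ltr_nat.
by congr (P _); apply/seteqP; split => w /=; rewrite jT.
Qed.

End forecast_hedge.

(** At [v = 0] the regret is the sum of [x_t * (1 - sgn(p_t))], whose terms are nonnegative. This
    provides the nonnegative integrand for [integral_le_expect]. *)
Lemma VCal_ge0 T (p : nat -> RR) x : (0 < T)%N ->
  (forall i : 'I_T, 0 <= p i.+1 <= 1) -> (0 <= VCal T p x)%E.
Proof.
move=> T0 p01; apply: (@le_trans _ _ (RegV T 0 p x)%:E); last first.
  by apply: ereal_sup_ubound; exists 0 => //=; rewrite in_itv /= lexx ler01.
rewrite lee_fin RegVE // sub0r normrN -[X in _ + X * _](ger0_norm (ler0n _ T)).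
rewrite -normrM betaE // ger0_norm; last first.
  by apply: sumr_ge0 => i _; case/andP: (xr_ge0_le1 x i.+1).
rewrite -big_split /=; apply: sumr_ge0 => i _.
rewrite sub0r subr0 mulNr addrC subr_ge0.
have /andP[x0 _] := xr_ge0_le1 x i.+1; rewrite -[leRHS]mulr1 ler_wpM2l //.
by case: sgrP.
Qed.

Theorem theorem4p7 :
  exists C : RR, forall (T : nat) (x : nat -> bool)
    (d : measure_display) (Omega : measurableType d)
    (P : probability Omega RR) (p : nat -> Omega -> RR),
    (0 < T)%N ->
    forecast_hedge P T x p ->
    (\int[P]_(w in setT) VCal T (fun t => p t w) x <=
       (C * Num.sqrt (T%:R : RR))%:E)%E.
Proof.
exists ((64 * 2600 + 4) * 8) => T x d Omega P p T0 fh.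
have [mp p1 p01 _ indep] := fh.
have p01' w (i : 'I_T) : 0 <= p i.+1 w <= 1.
  case: i => -[|i] iT /=; last by apply: p01; rewrite ltnS.
  by rewrite p1 invr_ge0 ler0n invf_le1 ?ltr0n // ler1n.
have tau0 : 0 < Num.sqrt (T%:R : RR) by rewrite sqrtr_gt0 ltr0n.
have tauT : Num.sqrt (T%:R : RR) ^+ 2 = T%:R by rewrite sqr_sqrtr.
pose D j := [set r : RR | below T j r].
have mD j : measurable (D j) by exact: measurable_below.
have mpD i j : measurable (p i @^-1` D j) := measurable_forecast fh i (mD j).
have Dsub i j k : (j <= k)%N -> p i @^-1` D j `<=` p i @^-1` D k.
  by move=> jk w; exact: below_mono.
pose Q j i := fine (P (p i.+1 @^-1` D j)).
have [||||G [G0 EG GR]] := @finite_forecast_hedge _ T (fun i => xr x i.+1) Q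
  _ T0 tau0 tauT (fun i => xr_ge0_le1 x i.+1).
- by move=> i; rewrite /Q (_ : _ @^-1` _ = set0) ?measure0 //; apply/seteqP; split.
- move=> i; rewrite /Q (_ : _ @^-1` _ = setT) ?probability_setT //.
  by apply/seteqP; split => w // _; rewrite /D /= ltnNge leqnSn /= gtn_eqF.
- move=> i j; apply: fine_le; rewrite ?fin_num_measure //.
  by apply: le_measure; rewrite ?inE //; exact: Dsub.
- by move=> i j iT jT; rewrite /Q (forecast_below T0 fh).
pose C (a : 'I_T.+2) := D a.+1 `\` D a.
have QC : (fun i (a : 'I_T.+2) => Q a.+1 i - Q a i) =
    (fun i a => fine (P (p i.+1 @^-1` C a))).
  apply/funext => i; apply/funext => a; rewrite -fine_probD //; exact: Dsub.
apply: (@le_trans _ _ (expect (fun i a => fine (P (p i.+1 @^-1` C a))) G)%:E); last first.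
  by rewrite -QC lee_fin.
apply: (integral_le_expect mp) => //.
- by move=> a; exact: measurableD.
- by move=> w; exact: (@VCal_ge0 T (fun t => p t w) x T0 (p01' w)).
(* The cell of a forecast is found from the first test it passes; test 0 always fails and test
   [T.+2] always succeeds. *)
- move=> w i; have ex : exists j, below T j (p i.+1 w).
    by exists T.+2; rewrite /= ltnNge leqnSn /= gtn_eqF.
  case: (ex_minnP ex) => -[//|j] bj jmin.
  have jT : (j < T.+2)%N by apply: jmin; rewrite /= ltnNge leqnSn /= gtn_eqF.
  exists (Ordinal jT); split => //= bj'.
  by have := jmin _ bj'; rewrite ltnn.
move=> w s ws; apply: ge_ereal_sup => _ [v v01 <-]; rewrite lee_fin RegVE //.
apply: (GR s (fun i => p i.+1 w)) => //; last exact: betaE.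
(* By monotonicity of the tests, the cell index determines the outcome of every test. *)
move=> i j _; have [b1 b2] := ws i; apply/idP/idP => [ij|bj].
  exact: below_mono b1.
by rewrite ltnNge; apply/negP => ji; apply: b2; exact: below_mono bj.
Qed.
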